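(* Let $\mathcal B$ be a nondegenerate bilinear form on a perm algebra $(A,\circ_A)$ satisfying $$\mathcal B(x\circ_A y,z)=\mathcal B(y,x\circ_A z)=\mathcal B(x\circ_A z,y),\qquad\forall x,y,z\in A.\quad( * )$$ Then there is a compatible special apre-perm algebra structure $(A,\triangleright_A,\triangleleft_A)$ on $(A,\circ_A)$ with multiplications $\triangleright_A,\triangleleft_A:A\otimes A\to A$ given respectively by $$\mathcal B(x\triangleright_A y,z)=\mathcal B(y,x\circ_A z+z\circ_A x),\qquad \mathcal B(x\triangleleft_A y,z)=-\mathcal B(x,z\circ_A y),\qquad\forall x,y,z\in A.$$ Moreover, $(\mathcal L^*_{\circ_A},-\mathcal L^*_{\triangleleft_A},A^* )$ and $(\mathcal L_{\circ_A},\mathcal R_{\circ_A},A)$ are equivalent as representations of $(A,\circ_A)$. Conversely, let $(A,\triangleright_A,\triangleleft_A)$ be a compatible special apre-perm algebra structure on a perm algebra $(A,\circ_A)$. If $(\mathcal L_{\circ_A},\mathcal R_{\circ_A},A)$ and $(\mathcal L^*_{\circ_A},-\mathcal L^*_{\triangleleft_A},A^* )$ are equivalent as representations of $(A,\circ_A)$, then there exists a nondegenerate bilinear form $\mathcal B$ on $(A,\circ_A)$ satisfying $( * )$.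
   Context: All vector spaces and algebras are finite-dimensional over an algebraically closed field $\mathbb K$ of characteristic zero. A perm algebra $(A,\circ_A)$ is a vector space with a bilinear operation satisfying $x\circ_A(y\circ_A z)=(x\circ_A y)\circ_A z=(y\circ_A x)\circ_A z$. A representation of it is a triple $(l,r,V)$ with linear maps $l,r:A\to\mathrm{End}_{\mathbb K}(V)$ such that $l(x\circ_A y)=l(x)l(y)=l(y)l(x)$ and $r(x\circ_A y)=r(y)r(x)=r(y)l(x)=l(x)r(y)$ for all $x,y\in A$. Representations $(l_1,r_1,V_1)$, $(l_2,r_2,V_2)$ are equivalent if there is a linear isomorphism $\phi:V_1\to V_2$ with $\phi l_1(x)=l_2(x)\phi$ and $\phi r_1(x)=r_2(x)\phi$ for all $x$. For a bilinear operation $\circ$ on $A$: $\mathcal L_\circ(x)y=x\circ y$, $\mathcal R_\circ(x)y=y\circ x$. For linear $\mu:A\to\mathrm{End}_{\mathbb K}(V)$, $\mu^*:A\to\mathrm{End}_{\mathbb K}(V^* )$ is $\langle\mu^*(x)u^*,v\rangle=\langle u^*,\mu(x)v\rangle$ (transpose, no sign). An apre-perm algebra is a vector space $A$ with multiplications $\triangleright_A,\triangleleft_A:A\otimes A\to A$ such that, setting $x\circ_A y=x\triangleright_A y+x\triangleleft_A y$ and $x\bullet_A y=x\triangleright_A y+y\triangleleft_A x$, $(A,\circ_A)$ is a perm algebra and for all $x,y,z\in A$: $(x\circ_A y)\bullet_A z=x\bullet_A(y\bullet_A z)=y\bullet_A(x\bullet_A z)$ and $z\triangleleft_A(x\circ_A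 y)=-(z\triangleleft_A y)\triangleleft_A x=x\bullet_A(z\triangleleft_A y)=(x\bullet_A z)\triangleleft_A y$. It is special if $\triangleleft_A$ is commutative. It is a compatible structure on a perm algebra $(A,\circ_A)$ if $\circ_A=\triangleright_A+\triangleleft_A$. *)

(* Defs.v *)
From HB Require Import structures.
From mathcomp Require Import all_boot all_order all_algebra.

Set Implicit Arguments.
Unset Strict Implicit.
Unset Printing Implicit Defensive.

Import GRing.Theory.
Local Open Scope ring_scope.

Section SumOperation.
Variables (K : fieldType) (A : vectType K).
Variables f g : {bilinear A -> A -> A}.

Definition sum_op (x y : A) : A := f x y + g x y.

Fact sum_op_bilinear : bilinear_for *:%R *:%R sum_op.
Proof.
split=> u a x y; rewrite /sum_op /=.
  by rewrite !linearPl /= scalerDr addrACA.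
by rewrite !linearPr /= scalerDr addrACA.
Qed.

HB.instance Definition _ :=
  bilinear_isBilinear.Build K A A A *:%R *:%R sum_op sum_op_bilinear.

End SumOperation.

Section Multiplications.
Variables (K : fieldType) (A : vectType K) (op : {bilinear A -> A -> A}).

Definition lmult : 'Hom(A, 'End(A)) := linfun (fun x : A => linfun (op x)).
Definition rmult : 'Hom(A, 'End(A)) :=
  linfun (fun x : A => linfun (applyr op x)).

(* [linfun] has its intended value only on linear arguments, which the
   evaluation lemmas below establish. *)
Fact lmult_linear : linear (fun x : A => linfun (op x)).
Proof.
by move=> a x y; apply/lfunP=> z; rewrite add_lfunE scale_lfunE !lfunE /= linearPl.
Qed.

Fact rmult_linear : linear (fun x : A => linfun (applyr op x)).
Proof.
by move=> a x y; apply/lfunP=> z; rewrite add_lfunE scale_lfunE !lfunE /= linearPr.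
Qed.

Lemma lmultE x y : lmult x y = op x y.
Proof.
pose F := GRing.isLinear.Build _ _ _ _ _ lmult_linear.
pose f : {linear A -> 'End(A)} := HB.pack (fun x : A => linfun (op x)) F.
by rewrite /lmult (lfunE f) /= lfunE.
Qed.

Lemma rmultE x y : rmult x y = op y x.
Proof.
pose F := GRing.isLinear.Build _ _ _ _ _ rmult_linear.
pose f : {linear A -> 'End(A)} := HB.pack (fun x : A => linfun (applyr op x)) F.
by rewrite /rmult (lfunE f) /= lfunE.
Qed.

End Multiplications.

Section DualAction.
Variables (K : fieldType) (A V : vectType K) (mu : 'Hom(A, 'End(V))).

(* The transpose, without sign: <mu^*(x) u, v> = <u, mu(x) v>. *)
Definition dual_action : 'Hom(A, 'End('Hom(V, K^o))) :=
  linfun (fun x : A => linfun (fun u : 'Hom(V, K^o) => (u \o mu x)%VF)).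

Fact dual_action_inner_linear x :
  linear (fun u : 'Hom(V, K^o) => (u \o mu x)%VF).
Proof. by move=> a u w; rewrite comp_lfunDl comp_lfunZl. Qed.

Lemma dual_action_innerE x (u : 'Hom(V, K^o)) :
  linfun (fun u : 'Hom(V, K^o) => (u \o mu x)%VF) u = (u \o mu x)%VF.
Proof.
pose F := GRing.isLinear.Build _ _ _ _ _ (dual_action_inner_linear x).
pose f : {linear 'Hom(V, K^o) -> 'Hom(V, K^o)} :=
  HB.pack (fun u : 'Hom(V, K^o) => (u \o mu x)%VF) F.
by rewrite (lfunE f).
Qed.

Fact dual_action_linear :
  linear (fun x : A => linfun (fun u : 'Hom(V, K^o) => (u \o mu x)%VF)).
Proof.
move=> a x y; apply/lfunP=> u; rewrite add_lfunE scale_lfunE.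
by rewrite !dual_action_innerE linearP /= comp_lfunDr comp_lfunZr.
Qed.

Lemma dual_actionE x (u : 'Hom(V, K^o)) v : dual_action x u v = u (mu x v).
Proof.
pose F := GRing.isLinear.Build _ _ _ _ _ dual_action_linear.
pose f : {linear A -> 'End('Hom(V, K^o))} := HB.pack
  (fun x : A => linfun (fun u : 'Hom(V, K^o) => (u \o mu x)%VF)) F.
by rewrite /dual_action (lfunE f) /= dual_action_innerE comp_lfunE.
Qed.

End DualAction.

Definition perm_algebra (K : fieldType) (A : vectType K)
    (op : {bilinear A -> A -> A}) : Prop :=
  forall x y z : A,
    op x (op y z) = op (op x y) z /\ op (op x y) z = op (op y x) z.

Section Representations.
Variables (K : fieldType) (A : vectType K) (op : {bilinear A -> A -> A}).

Definition perm_rep (V : vectType K) (l r : 'Hom(A, 'End(V))) : Prop :=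
  forall x y : A,
    [/\ l (op x y) = (l x \o l y)%VF,
        (l x \o l y = l y \o l x)%VF,
        r (op x y) = (r y \o r x)%VF,
        (r y \o r x = r y \o l x)%VF
      & (r y \o l x = l x \o r y)%VF].

Definition perm_rep_equiv (V1 V2 : vectType K)
    (l1 r1 : 'Hom(A, 'End(V1))) (l2 r2 : 'Hom(A, 'End(V2))) : Prop :=
  [/\ perm_rep l1 r1, perm_rep l2 r2
    & exists phi : 'Hom(V1, V2), bijective phi /\
        forall x : A, (phi \o l1 x = l2 x \o phi)%VF /\
                      (phi \o r1 x = r2 x \o phi)%VF].

End Representations.

Section AprePerm.
Variables (K : fieldType) (A : vectType K).
Variables rt lt : {bilinear A -> A -> A}.

Definition apre_perm_algebra : Prop :=
  let circ := sum_op rt lt in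
  let bul x y := rt x y + lt y x in
  perm_algebra circ /\
  forall x y z : A,
    [/\ bul (circ x y) z = bul x (bul y z),
        bul x (bul y z) = bul y (bul x z),
        lt z (circ x y) = - lt (lt z y) x,
        - lt (lt z y) x = bul x (lt z y)
      & bul x (lt z y) = lt (bul x z) y].

Definition special_apre_perm_algebra : Prop :=
  apre_perm_algebra /\ commutative lt.

Definition compatible_with (op : {bilinear A -> A -> A}) : Prop :=
  forall x y : A, op x y = rt x y + lt x y.

End AprePerm.

Section Forms.
Variables (K : fieldType) (A : vectType K) (B : {biscalar A}).

Definition nondegenerate_form : Prop :=
  (forall x : A, (forall y : A, B x y = 0) -> x = 0) /\
  (forall y : A, (forall x : A, B x y = 0) -> y = 0).

Definition invariant_form (op : {bilinear A -> A -> A}) : Prop :=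
  forall x y z : A, B (op x y) z = B y (op x z) /\ B y (op x z) = B (op x z) y.

End Forms.

(* Main.v *)
From HB Require Import structures.
Require Import Defs.
From mathcomp Require Import all_boot all_order all_algebra.

Import GRing.Theory.
Local Open Scope ring_scope.

(** Everything rests on one observation: when [lt] is commutative, the bullet
    product [rt x y + lt y x] is the perm product [circ x y] itself.  The axioms
    of a special apre-perm structure then reduce to the chain
      [lt z (circ x y) = - lt (lt z y) x = circ x (lt z y) = lt (circ x z) y],
    and this chain together with commutativity is what makes the transposes of
    [L_circ] and [- L_lt] a representation on the dual space
    ([special_apre_permP], [coregular_perm_rep]).

    From a form to a structure: nondegeneracy lets the prescribed scalars
    [- B x (circ z y)] and [B y (circ x z + circ z x)] be read as the covectors
    of products [lt x y] and [rt x y] ([form_defines_product]).  Each identity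
    between products is then checked by pairing with an arbitrary vector, where
    it becomes an identity of the perm product.  The form need not be symmetric,
    so the intertwiner must be chosen on the right side: it is
    [a |-> B _ a], for which both intertwining relations follow from
    invariance ([invariant_form_rep_equiv]).

    From an equivalence to a form: an isomorphism [phi] from the space to its
    dual is a nondegenerate form [B a v = phi a v].  Compatibility of [phi] with
    the left actions is the first half of invariance; compatibility with the
    right actions reads [B (circ a x) v = - B a (lt x v)], whose right-hand side
    is symmetric in [x] and [v], and this symmetry gives the second half
    ([rep_equiv_invariant_form]). *)

(** * Bilinear forms and the dual space *)

Section FormDuality.
Variables (K : fieldType) (A : vectType K).

Definition covector (f : A -> K) : 'Hom(A, K^o) := linfun (f : A -> K^o).

Lemma covectorE (f : A -> K) : scalar f -> covector f =1 f.
Proof.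
move=> f_lin v; pose F := GRing.isLinear.Build K A K^o *:%R f f_lin.
pose g : {linear A -> K^o} := HB.pack (f : A -> K^o) F.
exact: (lfunE g).
Qed.

Lemma covectors_separate (y : A) : (forall u : 'Hom(A, K^o), u y = 0) -> y = 0.
Proof.
move=> y0; rewrite (coord_vbasis (memvf y)) big1 // => i _.
have coord_lin : scalar (coord (vbasis fullv) i : A -> K).
  by move=> c v w; rewrite linearP.
by rewrite -(covectorE _ coord_lin) y0 scale0r.
Qed.

(** The form is a bare function with a proof of bilinearity so that the lemma
    also applies to a form with its two arguments exchanged. *)
Lemma form_dual_map (f : A -> A -> K) : bilinear_for *%R *%R f ->
  exists psi : 'Hom(A, 'Hom(A, K^o)), forall a v, psi a v = f a v.
Proof.
move=> [f_linl f_linr]; pose p a : 'Hom(A, K^o) := covector (f a).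
have p_lin : linear p.
  move=> c a b; apply/lfunP=> v.
  rewrite add_lfunE scale_lfunE /p !covectorE //; exact: f_linl.
pose F := GRing.isLinear.Build _ _ _ _ p p_lin.
pose g : {linear A -> 'Hom(A, K^o)} := HB.pack p F.
by exists (linfun p) => a v; rewrite (lfunE g) /= covectorE.
Qed.

(** A space and its dual have the same dimension, so an injective map between
    them has a two-sided linear inverse. *)
Lemma dual_inj_lfunVK (psi : 'Hom(A, 'Hom(A, K^o))) :
  injective psi -> cancel psi^-1%VF psi.
Proof.
move=> /lker0P psi_inj u; apply: limg_lfunVK.
suff /eqP-> : limg psi == fullv by rewrite memvf.
rewrite eqEdim subvf limg_dim_eq ?(eqP psi_inj) ?capv0 //.
have dim_dual : dim 'Hom(A, K^o) = (dim A * 1)%N by [].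
by rewrite !dimvf dim_dual muln1 leqnn.
Qed.

Lemma form_dual_iso (f : A -> A -> K) : bilinear_for *%R *%R f ->
    (forall x, (forall y, f x y = 0) -> x = 0) ->
  exists psi : 'Hom(A, 'Hom(A, K^o)),
    [/\ forall a v, psi a v = f a v, cancel psi psi^-1%VF
      & cancel psi^-1%VF psi].
Proof.
move=> f_bilin f_nondeg; have [psi psiE] := form_dual_map f f_bilin.
have psi_ker : lker psi == 0%VS.
  apply/eqP/vspaceP=> a; rewrite memv_ker memv0; apply/eqP/eqP=> [a0|->].
    by apply: f_nondeg => v; rewrite -psiE a0 zero_lfunE.
  exact: linear0.
exists psi; split=> //; first exact: lker0_lfunK.
by apply: dual_inj_lfunVK; apply/lker0P.
Qed.

Variable B : {biscalar A}.
Hypothesis B_nondeg : nondegenerate_form B.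

Lemma biscalar_bilinear : bilinear_for *%R *%R B.
Proof. by split=> u a x y; [exact: linearPl | exact: linearPr]. Qed.

Lemma biscalar_flip_bilinear : bilinear_for *%R *%R (fun x y => B y x).
Proof. by split=> u a x y; [exact: linearPr | exact: linearPl]. Qed.

Lemma form_ext x y : (forall z, B x z = B y z) -> x = y.
Proof.
move=> eqB; apply/subr0_eq/(proj1 B_nondeg)=> z.
by rewrite linearBl eqB subrr.
Qed.

(** Nondegeneracy makes [T x y] the covector of a unique vector, and
    uniqueness is what makes that vector depend bilinearly on [x] and [y]. *)
Lemma form_defines_product (T : A -> A -> A -> K) :
    (forall z, bilinear_for *%R *%R (fun x y => T x y z)) ->
    (forall x y, scalar (T x y)) ->
  exists m : {bilinear A -> A -> A}, forall x y z, B (m x y) z = T x y z.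
Proof.
move=> T_bilin T_lin.
have [psi [psiE _ psiVK]] := form_dual_iso B biscalar_bilinear B_nondeg.1.
pose m x y := (psi^-1)%VF (covector (T x y)).
have mE x y z : B (m x y) z = T x y z.
  by rewrite -psiE psiVK covectorE.
have m_bilin : bilinear_for *:%R *:%R m.
  split=> u a x y; apply: form_ext => z; rewrite linearPl !mE.
    exact: (T_bilin z).1.
  exact: (T_bilin z).2.
pose F := bilinear_isBilinear.Build K A A A *:%R *:%R m m_bilin.
pose m' : {bilinear A -> A -> A} := HB.pack m F.
by exists m'.
Qed.

End FormDuality.

(** * Special apre-perm structures and their representations *)

Section SpecialStructures.
Variables (K : fieldType) (A : vectType K) (circ : {bilinear A -> A -> A}).
Hypothesis permA : perm_algebra circ.

Lemma perm_assoc x y z : circ (circ x y) z = circ x (circ y z).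
Proof. by have [-> _] := permA x y z. Qed.

Lemma perm_left_comm x y z : circ x (circ y z) = circ y (circ x z).
Proof. by rewrite -!perm_assoc; have [_ ->] := permA x y z. Qed.

Section Structure.
Variables rt lt : {bilinear A -> A -> A}.
Hypothesis lt_comm : commutative lt.
Hypothesis compat : compatible_with rt lt circ.

(** Both the sum and the bullet product are [circ], so the axioms that do not
    isolate [lt] are those of a perm algebra. *)
Lemma special_apre_permP :
  apre_perm_algebra rt lt <->
  forall x y z, [/\ lt z (circ x y) = - lt (lt z y) x,
                    - lt (lt z y) x = circ x (lt z y)
                  & circ x (lt z y) = lt (circ x z) y].
Proof.
have sumE x y : sum_op rt lt x y = circ x y by rewrite compat.
have bulE x y : rt x y + lt y x = circ x y by rewrite lt_comm compat.
rewrite /apre_perm_algebra /=; split=> [[_ ax] x y z | ax].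
  by have [_ _] := ax x y z; rewrite !sumE !bulE.
split=> x y z; first by rewrite /= !sumE; exact: permA.
have [ax1 ax2 ax3] := ax x y z.
by split; rewrite !(sumE, bulE) //; [exact: perm_assoc | exact: perm_left_comm].
Qed.

End Structure.

Lemma regular_perm_rep : perm_rep circ (lmult circ) (rmult circ).
Proof.
move=> x y; split; apply/lfunP=> z; rewrite !(comp_lfunE, lmultE, rmultE).
- exact: perm_assoc.
- exact: perm_left_comm.
- by rewrite perm_assoc.
- by rewrite !perm_assoc perm_left_comm.
- exact: perm_assoc.
Qed.

Lemma neg_dual_lmultE (m : {bilinear A -> A -> A}) x (u : 'Hom(A, K^o)) v :
  (- dual_action (lmult m)) x u v = - u (m x v).
Proof. by rewrite !opp_lfunE dual_actionE lmultE. Qed.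

(** Transposition reverses composition, so the representation axioms on the dual
    ask how [circ] and [lt] compose on the space itself; by the chain and
    commutativity, each composite of [lt] with [lt] or [circ] is, up to sign,
    [lt (circ x y)]. *)
Lemma coregular_perm_rep (rt lt : {bilinear A -> A -> A}) :
    special_apre_perm_algebra rt lt -> compatible_with rt lt circ ->
  perm_rep circ (dual_action (lmult circ)) (- dual_action (lmult lt)).
Proof.
move=> [apre lt_comm] compat.
have ax := (special_apre_permP rt lt lt_comm compat).1 apre.
have lt_lt x y v : lt x (lt y v) = - lt (circ x y) v.
  have [ax1 _ _] := ax x y v.
  by rewrite lt_comm (lt_comm y) (lt_comm (circ x y)) ax1 opprK.
have circ_lt x y v : circ x (lt y v) = lt (circ x y) v.
  by have [_ _ ->] := ax x v y.
have lt_circ x y v : lt y (circ x v) = lt (circ x y) v.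
  by have [ax1 ax2 ax3] := ax x v y; rewrite ax1 ax2 ax3.
have lE x (u : 'Hom(A, K^o)) v : dual_action (lmult circ) x u v = u (circ x v).
  by rewrite dual_actionE lmultE.
have rE := neg_dual_lmultE lt.
have uN (u : 'Hom(A, K^o)) w : u (- w) = - u w by rewrite linearN.
move: (dual_action _) (- dual_action _) lE rE => l r lE rE x y.
split; apply/lfunP=> u; apply/lfunP=> v; rewrite ?comp_lfunE.
- by rewrite !lE perm_assoc perm_left_comm.
- by rewrite !lE perm_left_comm.
- by rewrite !rE lt_lt uN opprK.
- by rewrite !rE lE lt_lt uN opprK circ_lt.
- by rewrite lE !rE lE circ_lt lt_circ.
Qed.

(** * From an invariant form to a structure *)

Section FromForm.
Variable B : {biscalar A}.
Hypothesis B_nondeg : nondegenerate_form B.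
Hypothesis B_inv : invariant_form B circ.

Lemma form_adjoint x y z : B (circ x y) z = B y (circ x z).
Proof. by have [] := B_inv x y z. Qed.

(** A form that is not symmetric is still symmetric on products. *)
Lemma form_sym_circ x z y : B y (circ x z) = B (circ x z) y.
Proof. by have [] := B_inv x y z. Qed.

Lemma form_rotate x y z : B x (circ z y) = B y (circ z x).
Proof. by rewrite form_sym_circ form_adjoint. Qed.

Variables rt lt : {bilinear A -> A -> A}.
Hypothesis rtE : forall x y z, B (rt x y) z = B y (circ x z + circ z x).
Hypothesis ltE : forall x y z, B (lt x y) z = - B x (circ z y).

Lemma form_lt_comm : commutative lt.
Proof.
by move=> x y; apply: (form_ext _ _ B B_nondeg) => z; rewrite !ltE form_rotate.
Qed.

Lemma form_compatible : compatible_with rt lt circ.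
Proof.
move=> x y; apply: (form_ext _ _ B B_nondeg) => z.
rewrite linearDl rtE ltE linearDr form_adjoint (form_rotate x).
by rewrite addrK.
Qed.

Lemma form_special_apre_perm : special_apre_perm_algebra rt lt.
Proof.
split; last exact: form_lt_comm.
apply/(special_apre_permP _ _ form_lt_comm form_compatible) => x y z.
split; apply: (form_ext _ _ B B_nondeg) => w.
- by rewrite linearNl !ltE opprK perm_assoc perm_left_comm.
- rewrite form_adjoint linearNl !ltE opprK !perm_assoc.
  by rewrite perm_left_comm.
- by rewrite !form_adjoint !ltE form_adjoint perm_assoc.
Qed.

(** The intertwiner is inverse to [a |-> B _ a].  With [a |-> B a _] instead, the
    right actions would require [B (circ a x) v = - B a (lt x v)], while [ltE]
    only controls [lt x v] in the left argument of [B]. *)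
Lemma invariant_form_rep_equiv :
  perm_rep_equiv circ (dual_action (lmult circ)) (- dual_action (lmult lt))
    (lmult circ) (rmult circ).
Proof.
split; [ |exact: regular_perm_rep| ].
  exact: (coregular_perm_rep rt lt form_special_apre_perm form_compatible).
have [psi [psiE psiK psiVK]] :=
  form_dual_iso _ _ _ (biscalar_flip_bilinear _ _ B) B_nondeg.2.
have psi_l x a : psi (circ x a) = dual_action (lmult circ) x (psi a).
  apply/lfunP=> v; rewrite dual_actionE lmultE !psiE form_sym_circ.
  by rewrite form_adjoint form_sym_circ.
have psi_r x a : psi (circ a x) = (- dual_action (lmult lt)) x (psi a).
  apply/lfunP=> v; rewrite neg_dual_lmultE !psiE ltE opprK.
  by rewrite form_sym_circ form_adjoint.
exists (psi^-1)%VF; split=> [|x]; first by exists psi.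
split; apply/lfunP=> u; rewrite !comp_lfunE (lmultE, rmultE);
  apply: (can_inj psiK).
  by rewrite psi_l !psiVK.
by rewrite psi_r !psiVK.
Qed.

End FromForm.

(** * From an equivalence to an invariant form *)

Lemma rep_equiv_invariant_form (rt lt : {bilinear A -> A -> A}) :
    commutative lt ->
    perm_rep_equiv circ (lmult circ) (rmult circ)
      (dual_action (lmult circ)) (- dual_action (lmult lt)) ->
  exists B : {biscalar A}, nondegenerate_form B /\ invariant_form B circ.
Proof.
move=> lt_comm [_ _ [phi [phi_bij phi_eq]]].
pose b (a v : A) : K := phi a v.
have b_bilin : bilinear_for *%R *%R b.
  split=> u c x y; rewrite /b; last by rewrite linearP.
  by rewrite linearP add_lfunE scale_lfunE.
pose F := bilinear_isBilinear.Build K A A K *%R *%R b b_bilin.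
pose B : {biscalar A} := HB.pack b F.
have B_l x a v : b (circ x a) v = b a (circ x v).
  have [/lfunP/(_ a) + _] := phi_eq x; rewrite !comp_lfunE lmultE /b => ->.
  by rewrite dual_actionE lmultE.
have B_r x a v : b (circ a x) v = - b a (lt x v).
  have [_ /lfunP/(_ a)] := phi_eq x; rewrite !comp_lfunE rmultE /b => ->.
  by rewrite neg_dual_lmultE.
exists B; split; last first.
  move=> x y z; split; first exact: B_l.
  (* [B (circ x z) y = - B x (lt z y)] is unchanged when [y] and [z] are
     exchanged. *)
  by rewrite /= -B_l B_r lt_comm -B_r.
have phi_inj := bij_inj phi_bij.
split=> [x x0 | y y0].
  by apply: phi_inj; rewrite linear0; apply/lfunP=> v; rewrite zero_lfunE; exact: x0.
apply: covectors_separate => u.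
by have [phi' _ phi'K] := phi_bij; rewrite -(phi'K u); exact: y0.
Qed.

End SpecialStructures.

Theorem corollary3p26 (K : closedFieldType) (charK : [pchar K] =i pred0)
    (A : vectType K) (circ : {bilinear A -> A -> A})
    (permA : perm_algebra circ) :
  (forall B : {biscalar A},
      nondegenerate_form B -> invariant_form B circ ->
      exists rt lt : {bilinear A -> A -> A},
        [/\ special_apre_perm_algebra rt lt,
            compatible_with rt lt circ,
            forall x y z : A, B (rt x y) z = B y (circ x z + circ z x),
            forall x y z : A, B (lt x y) z = - B x (circ z y)
          & perm_rep_equiv circ
              (dual_action (lmult circ)) (- dual_action (lmult lt))
              (lmult circ) (rmult circ)])
  /\
  (forall rt lt : {bilinear A -> A -> A},
      special_apre_perm_algebra rt lt -> compatible_with rt lt circ ->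
      perm_rep_equiv circ
        (lmult circ) (rmult circ)
        (dual_action (lmult circ)) (- dual_action (lmult lt)) ->
      exists B : {biscalar A}, nondegenerate_form B /\ invariant_form B circ).
Proof.
split=> [B B_nondeg B_inv | rt lt [_ lt_comm] _]; last first.
  exact: rep_equiv_invariant_form.
have [rt rtE] : exists rt : {bilinear A -> A -> A},
    forall x y z, B (rt x y) z = B y (circ x z + circ z x).
  apply: (form_defines_product _ _ B B_nondeg
            (fun x y z => B y (circ x z + circ z x))).
    move=> z; split=> [y c x x' | x c y y'] /=; last by rewrite linearPl.
    by rewrite linearPl linearPr addrACA -scalerDr linearPr.
  move=> x y c z z' /=.
  by rewrite linearPr linearPl addrACA -scalerDr linearPr.
have [lt ltE] : exists lt : {bilinear A -> A -> A},
    forall x y z, B (lt x y) z = - B x (circ z y).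
  apply: (form_defines_product _ _ B B_nondeg (fun x y z => - B x (circ z y))).
    move=> z; split=> [y c x x' | x c y y'] /=.
      by rewrite linearPl opprD mulrN.
    by rewrite !linearPr opprD mulrN.
  by move=> x y c z z' /=; rewrite linearPl linearPr opprD mulrN.
exists rt, lt; split=> //.
- exact: (form_special_apre_perm _ _ _ permA B B_nondeg B_inv).
- exact: (form_compatible _ _ _ B B_nondeg B_inv).
- exact: (invariant_form_rep_equiv _ _ _ permA B B_nondeg B_inv rt).
Qed.
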